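(* Let $H$ be a real Hilbert space, let $\Theta$ be a finite-dimensional real Hilbert space, let $\Phi\in C^2(\Theta;H)$, assume that $F:H\to H$ is locally Lipschitz, and let $\tau>0$ and $\varepsilon\ge 0$. Assume in addition that there is a constant $C_g>0$ such that $$\|g(\theta)\|_\Theta\le C_g\,(1+\|\theta\|_\Theta)\qquad\text{for all }\theta\in\Theta.$$ Then every maximal solution of the system $$\dot\theta=v,\qquad \tau^2\dot v+M_\varepsilon(\theta)v=g(\theta)$$ with initial datum $(\theta(0),v(0))=(\theta^0,v^0)\in\Theta\times\Theta$ is global, i.e. its maximal interval of existence is $[0,\infty)$.
   Context: For $\theta\in\Theta$, $J(\theta):\Theta\to H$ is the linear map $J(\theta)w:=D\Phi(\theta)[w]$, and $J(\theta)^*:H\to\Theta$ is its adjoint with respect to the inner products of $H$ and $\Theta$. Set $f(\theta):=F(\Phi(\theta))\in H$, $M_\varepsilon(\theta):=J(\theta)^*J(\theta)+\varepsilon^2 I$, and $g(\theta):=J(\theta)^*f(\theta)$. A solution on $[0,T_{\max})$, $T_{\max}\in(0,\infty]$, is maximal if it cannot be extended to a solution on any larger interval $[0,T')$ with $T'>T_{\max}$. *)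

(* Defs.v *)
From HB Require Import structures.
From mathcomp Require Import all_boot all_order all_algebra.
From mathcomp Require Import all_classical all_reals all_analysis.

Set Implicit Arguments.
Unset Strict Implicit.
Unset Printing Implicit Defensive.

Import Order.TTheory GRing.Theory Num.Theory.
Import numFieldNormedType.Exports.

Local Open Scope classical_set_scope.
Local Open Scope ring_scope.

HB.mixin Record CompleteNormedModule_isHilbert (R : realType) (H : Type)
    of CompleteNormedModule R H := {
  inner : {dot H for idfun};
  norm_inner : forall x : H, `|x| = Num.sqrt (inner x x)
}.

#[short(type="hilbertType")]
HB.structure Definition Hilbert (R : realType) :=
  {H of CompleteNormedModule R H & CompleteNormedModule_isHilbert R H}.

#[short(type="finHilbertType")]
HB.structure Definition FinHilbert (R : realType) :=
  {H of Hilbert R H & Vector R H}.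

Definition locally_lipschitz (R : realType) (V W : normedModType R)
    (F : V -> W) : Prop :=
  forall x : V, exists2 U, nbhs x U & [lipschitz F y | y in U].

(* Twice continuously Fréchet differentiable: [D2 x] is the derivative at [x]
   of [y |-> 'd f y], as a map into the bounded operators with the operator
   norm. A bound [`|A w| <= c * `|w|] for all [w] says that the operator norm
   of [A] is at most [c]; similarly for bilinear maps. *)
Definition C2 (R : realType) (V W : normedModType R) (f : V -> W) : Prop :=
  (forall x : V, differentiable f x) /\
  exists D2 : V -> {bilinear V -> V -> W},
    [/\ forall x : V, exists M : R, forall h w : V,
          `|D2 x h w| <= M * `|h| * `|w|,
        forall (x : V) (e : R), 0 < e -> \forall h \near (0 : V),
          forall w : V,
          `|'d f (x + h) w - 'd f x w - D2 x h w| <= e * `|h| * `|w|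
      & forall (x : V) (e : R), 0 < e -> \forall y \near x,
          forall h w : V, `|D2 y h w - D2 x h w| <= e * `|h| * `|w|].

(* The Hilbert adjoint of [A], chosen as the [z] representing
   [w |-> inner y (A w)]; such a [z] exists, uniquely, when [A] is linear and
   bounded. *)
Definition adjoint (R : realType) (V W : hilbertType R) (A : V -> W) (y : W) :
    V :=
  get [set z : V | forall w : V, inner z w = inner y (A w)].

(* The derivative at [t] of [u] as a function on [I]: one-sided at an endpoint
   of [I] belonging to [I]. *)
Definition is_derive_on (R : realType) (V : normedModType R) (I : set R)
    (u : R -> V) (t : R) (l : V) : Prop :=
  (fun s => (s - t)^-1 *: (u s - u t)) @ (within I t^') --> l.

Section system.
Context {R : realType} {Theta : finHilbertType R} {H : hilbertType R}.
Variables (Phi : Theta -> H) (F : H -> H) (tau eps : R).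

Definition Jac (theta : Theta) (w : Theta) : H := 'd Phi theta w.

Definition Jac_adj (theta : Theta) : H -> Theta := adjoint (Jac theta).

Definition residual (theta : Theta) : H := F (Phi theta).

Definition Meps (theta : Theta) (w : Theta) : Theta :=
  Jac_adj theta (Jac theta w) + eps ^+ 2 *: w.

Definition grad (theta : Theta) : Theta := Jac_adj theta (residual theta).

Definition time_interval (T : \bar R) : set R :=
  [set t | 0 <= t /\ (t%:E < T)%E].

(* Values of [theta] and [v] outside [time_interval T] are irrelevant. *)
Definition is_solution (theta0 v0 : Theta) (T : \bar R)
    (theta v : R -> Theta) : Prop :=
  [/\ theta 0 = theta0, v 0 = v0
    & forall t, time_interval T t ->
        is_derive_on (time_interval T) theta t (v t) /\
        exists2 a, is_derive_on (time_interval T) v t a &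
          tau ^+ 2 *: a + Meps (theta t) (v t) = grad (theta t)].

Definition is_maximal_solution (theta0 v0 : Theta) (T : \bar R)
    (theta v : R -> Theta) : Prop :=
  is_solution theta0 v0 T theta v /\
  ~ exists (T' : \bar R) (theta' v' : R -> Theta),
      [/\ (T < T')%E, is_solution theta0 v0 T' theta' v'
        & forall t, time_interval T t -> theta' t = theta t /\ v' t = v t].

End system.

(* Main.v *)
Require Import Defs.
From HB Require Import structures.
From mathcomp Require Import all_boot all_order all_algebra.
From mathcomp Require Import all_classical all_reals all_analysis.
From mathcomp Require Import ring lra.
Import Order.TTheory GRing.Theory Num.Theory.
Import numFieldNormedType.Exports.
Local Open Scope classical_set_scope.
Local Open Scope ring_scope.

Set Implicit Arguments.
Unset Strict Implicit.
Unset Printing Implicit Defensive.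

(** A solution that lives only up to a finite time [T] can be continued, and is
    therefore not maximal. The system is the first-order equation [p' = X p] for
    the pair [p = (theta, v)], with [X] the [vector_field] below.

    Nothing blows up before [T]. The inner product of [v] with
    [Meps theta v] is [|J v|^2 + eps^2 |v|^2 >= 0], so the damping can only
    decrease the energy [1 + |theta|^2 + |v|^2], and the linear growth of the
    gradient bounds the derivative of the energy by a multiple of itself;
    Gronwall's inequality ([gronwall]) then bounds [theta] and [v] on [[0, T)]
    ([energy_bound]).

    Hence the solution has a limit at [T] ([left_limit]). As [v] is bounded,
    [theta] is Lipschitz and converges. The operators [J] are uniformly bounded
    near the limit of [theta], so [v'] is bounded near [T] and [v] converges
    too. In this order, bounds of [J] near a single point replace a compactness
    argument on the bounded set swept by [theta].

    The field [X] is locally Lipschitz ([lipschitz_vector_field]): since [Phi]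
    is [C2], its derivative is locally Lipschitz in operator norm, and this
    passes to the adjoint by duality ([norm_adjointB_le]). So Picard iteration
    ([picard]) solves the equation on both sides of [T], starting from the limit
    found above, and following the old solution before [T] and the new one
    afterwards gives a solution on a longer interval ([ode_extend]).

    Picard iteration needs antiderivatives of continuous curves in
    [Theta * Theta]. They are computed coordinatewise: by the Riesz
    representation ([riesz]) the coordinates of a vector of [Theta] are inner
    products with fixed vectors, hence continuous, and the fundamental theorem
    of calculus applies to each of them. *)

(** * Derivatives on a set of times *)

Section derivative.
Context {R : realType}.
Implicit Types V W : normedModType R.

(** The little-o form of the derivative avoids the quotient, hence the
    exclusion of the base point, and is the form in which estimates and
    restrictions to smaller sets are made below. *)
Lemma is_derive_onP V (I : set R) (u : R -> V) t l :
  is_derive_on I u t l <->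
  forall e, 0 < e -> \forall s \near t,
    I s -> `|u s - u t - (s - t) *: l| <= e * `|s - t|.
Proof.
have quotE s : s != t ->
    `|u s - u t - (s - t) *: l| = `|s - t| * `|l - (s - t)^-1 *: (u s - u t)|.
  move=> st; rewrite -normrZ scalerBr scalerA divff ?subr_eq0// scale1r.
  by rewrite distrC.
split=> [/cvgrPdist_le ul e e0|ul].
  have := ul e e0; rewrite !near_withinE => ule.
  near=> s => Is; have [->|st] := eqVneq s t.
    by rewrite !subrr scale0r subrr !normr0 mulr0.
  rewrite quotE// mulrC ler_wpM2r//.
  by move: st Is; near: s.
apply/cvgrPdist_le => e e0; rewrite !near_withinE.
near=> s => st Is.
have : `|u s - u t - (s - t) *: l| <= e * `|s - t|.
  by move: Is; near: s; exact: ul.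
by rewrite quotE// mulrC ler_pM2r// normr_gt0 subr_eq0.
Unshelve. all: by end_near. Qed.

Lemma is_derive_onT V (u : R -> V) (t : R) l :
  is_derive t (1 : R) u l <-> is_derive_on setT u t l.
Proof.
have E : (fun h : R => h^-1 *: ((u \o shift t) (h *: 1) - u t)) @ 0^' --> l <->
    is_derive_on setT u t l.
  rewrite /is_derive_on withinET.
  pose Q (e : R) (h : R) := h != 0 ->
    `|l - h^-1 *: ((u \o shift t) (h *: 1) - u t)| <= e.
  have QE e : (\forall h \near (0 : R), Q e h) = \forall s \near t, s != t ->
      `|l - (s - t)^-1 *: (u s - u t)| <= e.
    rewrite (near_shift t 0); congr (nbhs t _); apply: funext => s /=.
    by rewrite /Q /= sub0r subr_eq0 /GRing.scale /= mulr1 subrK.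
  split=> /cvgrPdist_le ul; apply/cvgrPdist_le => e /ul; rewrite !near_withinE.
    by rewrite -[X in X -> _]/(\forall h \near (0 : R), Q e h) QE.
  by rewrite -[X in _ -> X]/(\forall h \near (0 : R), Q e h) QE.
rewrite -E; split=> [[du <-]|ul]; first exact: du.
by split; [apply/cvg_ex; exists l|apply/cvg_lim].
Qed.

(** Differentiability is local: only the germ of the function at [t] matters,
    and the set of times may be shrunk or, away from its ends, enlarged. *)
Lemma is_derive_on_near (V : normedModType R) (I J : set R) (u w : R -> V) t l :
  (\forall s \near t, J s -> I s /\ w s = u s) -> w t = u t ->
  is_derive_on I u t l -> is_derive_on J w t l.
Proof.
move=> IJ wt /is_derive_onP ul; apply/is_derive_onP => e e0.
apply: filterS2 IJ (ul e e0) => s + us Js.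
by move=> /(_ Js)[Is ->]; rewrite wt us.
Qed.

Lemma is_derive_on_le V (I : set R) (u : R -> V) t l K :
  is_derive_on I u t l -> `|l| <= K ->
  forall e, 0 < e -> \forall s \near t, I s -> `|u s - u t| <= (K + e) * `|s - t|.
Proof.
move=> /is_derive_onP ul lK e /ul; apply: filterS => s /[apply] us.
rewrite -(subrK ((s - t) *: l) (u s - u t)) (le_trans (ler_normD _ _))//.
by rewrite addrC mulrDl lerD// normrZ mulrC ler_wpM2r.
Qed.

Lemma is_derive_on_cvg (V : normedModType R) I (u : R -> V) t l :
  is_derive_on I u t l -> u @ within I (nbhs t) --> u t.
Proof.
move=> ul; have l1 : 0 < `|l| + 1 by rewrite ltr_wpDl.
apply/cvgrPdist_le => e e0; rewrite near_withinE.
near=> s => Is; rewrite distrC.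
have us : `|u s - u t| <= (`|l| + 1) * `|s - t|.
  by move: Is; near: s; exact: (is_derive_on_le ul (lexx _) ltr01).
rewrite (le_trans us)// -ler_pdivlMl// distrC; near: s.
by apply: cvgr_dist_le; [exact: cvg_id|rewrite mulr_gt0// invr_gt0].
Unshelve. all: by end_near. Qed.

Lemma is_derive_onD (V : normedModType R) I (f g : R -> V) t df dg :
  is_derive_on I f t df -> is_derive_on I g t dg ->
  is_derive_on I (fun s => f s + g s) t (df + dg).
Proof.
move=> fd gd; rewrite /is_derive_on.
under eq_fun do rewrite opprD addrACA scalerDr.
exact: cvgD.
Qed.

Lemma is_derive_onB (V : normedModType R) I (f g : R -> V) t df dg :
  is_derive_on I f t df -> is_derive_on I g t dg ->
  is_derive_on I (fun s => f s - g s) t (df - dg).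
Proof.
move=> fd gd; rewrite /is_derive_on.
under eq_fun do rewrite opprD addrACA -opprD scalerBr.
exact: cvgB.
Qed.

Lemma is_derive_on_scale (V : normedModType R) I (f : R -> R) (b : V) t df :
  is_derive_on I f t df -> is_derive_on I (fun s => f s *: b) t (df *: b).
Proof.
move=> fd; rewrite /is_derive_on.
under eq_fun do rewrite -scalerBl scalerA.
by apply: cvgZr_tmp; exact: fd.
Qed.

Lemma is_derive_on_cst (V : normedModType R) I (b : V) t :
  is_derive_on I (fun=> b) t 0.
Proof.
rewrite /is_derive_on; under eq_fun do rewrite subrr scaler0.
exact: cvg_cst.
Qed.

Lemma is_derive_on_id (I : set R) (t : R) : is_derive_on I (@id R) t (1 : R).
Proof.
apply/is_derive_onP => e e0; apply: (@filterE _ (nbhs t)) => s _.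
by rewrite /GRing.scale /= mulr1 subrr normr0 mulr_ge0// ltW.
Qed.

Lemma is_derive_on_pair (V W : normedModType R) I (f : R -> V) (g : R -> W) t df dg :
  is_derive_on I f t df -> is_derive_on I g t dg ->
  is_derive_on I (fun s => (f s, g s)) t (df, dg).
Proof. move=> fd gd; rewrite /is_derive_on; exact: (cvg_pair fd gd). Qed.

(** For a fixed slack [e], the times [t] at which
    [|u t - u a| <= (K + e) (t - a)] holds form a set that contains its supremum
    and cannot stop before [b], because the estimate near the supremum reaches
    both sides of it. Then [e] tends to [0]. *)
Lemma local_to_global_lipschitz V (u : R -> V) (a b K : R) : a <= b ->
  (forall t e, a <= t <= b -> 0 < e ->
     \forall s \near t, a <= s <= b -> `|u s - u t| <= (K + e) * `|s - t|) ->
  `|u b - u a| <= K * (b - a).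
Proof.
move=> ab ul.
have [->|anb] := eqVneq a b; first by rewrite !subrr normr0 mulr0.
have {anb} ltab : a < b by rewrite lt_neqAle anb.
suff uK e : 0 < e -> `|u b - u a| <= (K + e) * (b - a).
  apply/ler_addgt0Pr => e e0.
  have := uK (e / (b - a)) (divr_gt0 e0 _); rewrite subr_gt0 => /(_ ltab).
  by rewrite mulrDl divfK// subr_eq0 gt_eqF.
move=> e0; pose A := [set t | a <= t <= b /\ `|u t - u a| <= (K + e) * (t - a)].
have Aa : A a by split; rewrite ?lexx ?subrr ?normr0 ?mulr0.
have supA : has_sup A by split; [exists a|exists b => t [/andP[]]].
have Ale t : A t -> t <= sup A by move=> At; apply: sup_upper_bound.
pose c := sup A.
have ac : a <= c by exact: Ale.
have cb : c <= b by apply: sup_le_ub; [exists a|move=> t [/andP[]]].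
have acb : a <= c <= b by rewrite ac.
have [d /= d0 ucd] := (@nbhs_ballP _ _ _ _).1 (ul c e acb e0).
have stepc s : `|s - c| < d -> a <= s <= b -> `|u s - u c| <= (K + e) * `|s - c|.
  by move=> scd; apply: ucd; rewrite -ball_normE /= distrC.
have Ac : A c.
  split => //; have [t At ct] := sup_adherent d0 supA.
  have tc : t <= c by exact: Ale.
  have := stepc t; rewrite distrC ger0_norm ?subr_ge0// => /(_ _ At.1).
  have -> : c - t < d by rewrite -/c in ct; lra.
  move=> /(_ isT); rewrite distrC => ut.
  have -> : (K + e) * (c - a) = (K + e) * (c - t) + (K + e) * (t - a) by ring.
  by rewrite (le_trans (ler_distD (u t) _ _))// lerD// At.2.
suff -> : b = c by exact: Ac.2.
apply/eqP; rewrite eq_le cb andbT leNgt; apply/negP => ltcb.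
(* a time of [A] strictly after its supremum *)
pose s := Num.min b (c + d / 2).
have cs : c < s by rewrite lt_min ltcb ltrDl divr_gt0.
have sb : s <= b by rewrite ge_min lexx.
have sd : s <= c + d / 2 by rewrite ge_min lexx orbT.
suff /Ale : A s by rewrite leNgt cs.
split; first by rewrite sb (le_trans ac (ltW cs)).
have := stepc s; rewrite gtr0_norm ?subr_gt0// sb (le_trans ac (ltW cs)).
have -> : s - c < d by lra.
move=> /(_ isT isT) us.
have -> : (K + e) * (s - a) = (K + e) * (s - c) + (K + e) * (c - a) by ring.
by rewrite (le_trans (ler_distD (u c) _ _))// lerD// Ac.2.
Qed.

Lemma mean_value_ineq V (u u' : R -> V) (a b K : R) : a <= b ->
  (forall t, a <= t <= b -> is_derive_on `[a, b] u t (u' t)) ->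
  (forall t, a <= t <= b -> `|u' t| <= K) ->
  `|u b - u a| <= K * (b - a).
Proof.
move=> ab du uK; apply: local_to_global_lipschitz => // t e tab e0.
have := is_derive_on_le (du t tab) (uK t tab) e0.
by apply: filterS => s /= us sab; apply: us; rewrite in_itv.
Qed.

End derivative.

(** * Hilbert spaces *)

Section hilbert.
Context {R : realType} {H : hilbertType R}.
Implicit Types x y z : H.

Lemma innerC x y : inner x y = inner y x.
Proof. by rewrite hermC expr0 mul1r. Qed.

Lemma innerxx x : inner x x = `|x| ^+ 2.
Proof.
rewrite norm_inner sqr_sqrtr//; have [->|x0] := eqVneq x 0.
  by rewrite linear0l.
by apply/ltW/neq0_dnorm_gt0.
Qed.

(** Expand [0 <= | |y| x - |x| y |^2] and divide by [2 |x| |y|]. *)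
Lemma cauchy_schwarz x y : inner x y <= `|x| * `|y|.
Proof.
have [->|x0] := eqVneq x 0; first by rewrite linear0l normr0 mul0r.
have [->|y0] := eqVneq y 0; first by rewrite linear0r normr0 mulr0.
have nx : 0 < `|x| by rewrite normr_gt0.
have ny : 0 < `|y| by rewrite normr_gt0.
have := sqr_ge0 `| `|y| *: x - `|x| *: y |.
rewrite -innerxx linearBl !linearBr !linearZl_LR !linearZr_LR/= !innerxx.
rewrite (innerC y x) /GRing.scale/= => h.
rewrite -subr_ge0 -(pmulr_rge0 _ (mulr_gt0 nx ny)).
by nra.
Qed.

Lemma norm_inner_le x y : `|inner x y| <= `|x| * `|y|.
Proof.
rewrite ler_norml cauchy_schwarz andbT lerNl.
by rewrite -linearNl -[`|x|]normrN cauchy_schwarz.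
Qed.

(** Take [w := z]. *)
Lemma norm_le_inner z (K : R) : 0 <= K ->
  (forall w, inner z w <= K * `|w|) -> `|z| <= K.
Proof.
move=> K0 /(_ z); rewrite innerxx expr2.
have [->|z0] := eqVneq z 0; first by rewrite normr0.
by rewrite ler_pM2r// normr_gt0.
Qed.

Lemma cvg_inner (T : Type) (F : set_system T) {FF : Filter F} (f g : T -> H) x y :
  f @ F --> x -> g @ F --> y -> (fun t => inner (f t) (g t)) @ F --> inner x y.
Proof.
move=> fx gy.
have -> : (fun t => inner (f t) (g t)) = (fun t => inner (f t - x) (g t - y) +
    (inner x (g t - y) + inner (f t - x) y + inner x y)).
  apply/funext => t; rewrite !linearBl !linearBr /=.
  by ring.
have f0 : (fun t => `|f t - x|) @ F --> (0 : R).
  by rewrite -(@normr0 _ H) -(subrr x); apply: cvg_norm; apply: cvgB; [|exact: cvg_cst].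
have g0 : (fun t => `|g t - y|) @ F --> (0 : R).
  by rewrite -(@normr0 _ H) -(subrr y); apply: cvg_norm; apply: cvgB; [|exact: cvg_cst].
have dom (h : T -> R) (k : T -> R) : (forall t, `|h t| <= k t) ->
    k @ F --> (0 : R) -> h @ F --> (0 : R).
  move=> hk k0; apply/norm_cvg0P; apply: (squeeze_cvgr _ (cvg_cst 0) k0).
  by apply: nearW => t; rewrite normr_ge0 hk.
rewrite -[X in _ --> X]add0r; apply: cvgD.
  apply: (dom _ _ (fun t => norm_inner_le _ _)).
  by rewrite -(mulr0 0); apply: cvgM.
rewrite -[X in _ --> X]add0r; apply: cvgD; last exact: cvg_cst.
rewrite -[X in _ --> X]add0r; apply: cvgD.
  apply: (dom _ _ (fun t => norm_inner_le _ _)).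
  by rewrite -(mulr0 `|x|); apply: cvgM => //; exact: cvg_cst.
apply: (dom _ _ (fun t => norm_inner_le _ _)).
by rewrite -(mul0r `|y|); apply: cvgM => //; exact: cvg_cst.
Qed.

(** By bilinearity the difference quotient of [|u|^2] is the inner product of
    that of [u] with [u s + u t], and the inner product is continuous. *)
Lemma is_derive_on_normsq I (u : R -> H) t l :
  is_derive_on I u t l ->
  is_derive_on I (fun s => `|u s| ^+ 2) t (2 * inner (u t) l).
Proof.
move=> ul; have uc : u @ within I t^' --> u t.
  apply/cvgrPdist_le => e e0; have /cvgrPdist_le/(_ e e0) := is_derive_on_cvg ul.
  by rewrite !near_withinE; apply: filterS => s us _.
have -> : 2 * inner (u t) l = inner l (u t + u t).
  by rewrite linearDr /= (innerC l); ring.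
rewrite /is_derive_on.
under eq_fun => s.
  have -> : (s - t)^-1 *: (`|u s| ^+ 2 - `|u t| ^+ 2) =
      inner ((s - t)^-1 *: (u s - u t)) (u s + u t).
    rewrite linearZl_LR linearBl !linearDr /= !innerxx (innerC (u t) (u s)).
    by rewrite /GRing.scale /=; ring.
  over.
by apply: cvg_inner => //; apply: cvgD => //; exact: cvg_cst.
Qed.

End hilbert.

Section riesz.
Context {R : realType} {V : finHilbertType R} {H : hilbertType R}.

(** The map sending [z] to its inner products with a basis is injective, since
    a vector in its kernel is orthogonal to itself, hence surjective by
    dimension: some [r] has the prescribed inner products with the basis. *)
Lemma riesz (phi : V -> R) : scalar phi ->
  exists r, forall w, inner r w = phi w.
Proof.
move=> phi_lin; pose b := vbasis {:V}.
pose f (z : V) := \row_j inner z b`_j : 'rV[R]_(\dim {:V}).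
have f_lin : linear f.
  by move=> a x y; apply/rowP => j; rewrite !mxE linearPl.
pose fL : {linear V -> 'rV[R]_(\dim {:V})} :=
  HB.pack f (GRing.isLinear.Build _ _ _ _ f f_lin).
have expand w : w = \sum_i coord b i w *: b`_i by rewrite -coord_vbasis ?memvf.
have kerf : (fullv :&: lker (linfun fL))%VS = 0%VS.
  apply/eqP; rewrite -subv0; apply/subvP => z; rewrite memv_cap memv_ker lfunE /=.
  move=> /andP[_ /eqP/rowP fz]; rewrite memv0 -normr_eq0 -sqrf_eq0 -innerxx.
  rewrite [X in inner z X]expand linear_sumr big1// => i _.
  by rewrite linearZr_LR/=; have := fz i; rewrite !mxE => ->; rewrite mulr0.
have full : limg (linfun fL) = fullv.
  by apply/eqP; rewrite eqEdim subvf (limg_dim_eq kerf) !dimvf /dim /= mul1n.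
have : (\row_j phi b`_j : 'rV[R]_(\dim {:V})) \in limg (linfun fL).
  by rewrite full memvf.
move=> /memv_imgP[r _]; rewrite lfunE /= => /rowP rE; exists r => w.
rewrite [in LHS](expand w) [in RHS](expand w) linear_sumr.
pose phiL : {scalar V} := HB.pack phi (GRing.isLinear.Build _ _ _ _ phi phi_lin).
rewrite -[RHS]/(phiL _) linear_sum; apply: eq_bigr => i _.
by rewrite linearZr_LR linearZ /=; have := rE i; rewrite !mxE => ->.
Qed.

Lemma adjointP (A : {linear V -> H}) y w : inner (adjoint A y) w = inner y (A w).
Proof.
have [|r rE] := @riesz (fun w => inner y (A w)).
  by move=> a u v; rewrite linearP linearPr.
by move: w; apply: (@getPex _ [set z | forall w, inner z w = inner y (A w)]); exists r.
Qed.

(** Test against [w]: the difference of the adjoints gives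
    [<y, A w> - <z, B w> = <y - z, A w> + <z, A w - B w>]. This transfers a
    Lipschitz dependence of an operator on a parameter to its adjoint. *)
Lemma norm_adjointB_le (A B : {linear V -> H}) y z M D : 0 <= M -> 0 <= D ->
  (forall w, `|A w| <= M * `|w|) -> (forall w, `|A w - B w| <= D * `|w|) ->
  `|adjoint A y - adjoint B z| <= M * `|y - z| + D * `|z|.
Proof.
move=> M0 D0 AM AB; apply: norm_le_inner => [|w].
  by rewrite addr_ge0// mulr_ge0.
have -> : inner (adjoint A y - adjoint B z) w = inner (y - z) (A w) + inner z (A w - B w).
  rewrite linearBl; have /= -> := adjointP A y w; have /= -> := adjointP B z w.
  by rewrite linearBl linearBr /=; ring.
rewrite mulrDl lerD// (le_trans (cauchy_schwarz _ _))//.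
  by rewrite (mulrC M) -mulrA ler_wpM2l.
by rewrite (mulrC D) -mulrA ler_wpM2l.
Qed.

End riesz.

(** * Antiderivatives of continuous curves *)

Section antiderivative.
Context {R : realType}.

(** The bounded window [(-1, 1)] is enough for local existence, and makes the
    scalar case an integral over a compact interval. *)
Definition has_antiderivatives (V : normedModType R) := forall c : R -> V,
  continuous c -> exists2 C : R -> V, C 0 = 0 &
    forall t, `|t| < 1 -> is_derive_on setT C t (c t).

Lemma has_antiderivatives_real : has_antiderivatives R.
Proof.
move=> c cc; pose mu := @lebesgue_measure R.
pose F (x : R) := \int[mu]_(t in `[-1, x]) c t.
exists (fun t => F t - F 0); first by rewrite subrr.
move=> t; rewrite ltr_norml => /andP[t1 t2].
have ic : mu.-integrable `[-1, 1] (EFin \o c).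
  apply: continuous_compact_integrable; first exact: segment_compact.
  exact: continuous_subspaceT.
have [|dF <-] := continuous_FTC1 t2 ic _ (cc t).
  by rewrite lte_fin.
rewrite -[X in is_derive_on _ _ _ X]addr0.
apply: is_derive_onD; last exact: is_derive_on_cst.
by apply/is_derive_onT; rewrite derive1E; exact: derivableP.
Qed.

(** Each coordinate of [c t] is the inner product of [c t] with a fixed vector,
    so it is continuous in [t] and has a scalar antiderivative. *)
Lemma has_antiderivatives_fin (V : finHilbertType R) : has_antiderivatives V.
Proof.
move=> c cc; pose b := vbasis {:V}.
have /choice[r rE] i : exists r : V, forall w, inner r w = coord b i w.
  by apply: riesz => a x y; rewrite linearP.
have /choice[C CP] i : exists C : R -> R, C 0 = 0 /\
    forall t, `|t| < 1 -> is_derive_on setT C t (inner (r i) (c t)).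
  have [|C C0 dC] := @has_antiderivatives_real (fun t => inner (r i) (c t)).
    by move=> t; apply: cvg_inner; [exact: cvg_cst|exact: cc].
  by exists C.
exists (fun t => \sum_i C i t *: b`_i).
  by rewrite big1// => i _; rewrite (CP i).1 scale0r.
move=> t t1; rewrite (coord_vbasis (memvf (c t))) -/b -fct_sumE.
apply: (big_ind2 (fun f d => is_derive_on setT f t d)).
- exact: is_derive_on_cst.
- by move=> f df g dg; exact: is_derive_onD.
- move=> i _; rewrite -rE; apply: is_derive_on_scale.
  exact: (CP i).2.
Qed.

Lemma has_antiderivatives_pair (V W : normedModType R) : has_antiderivatives V ->
  has_antiderivatives W -> has_antiderivatives (V * W)%type.
Proof.
move=> hV hW c cc.
have [|C1 C10 dC1] := hV (fun t => (c t).1).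
  by move=> t; apply: cvg_comp (cc t) _; exact: cvg_fst.
have [|C2 C20 dC2] := hW (fun t => (c t).2).
  by move=> t; apply: cvg_comp (cc t) _; exact: cvg_snd.
exists (fun t => (C1 t, C2 t)); first by rewrite C10 C20.
by move=> t t1; rewrite [c t]surjective_pairing; apply: is_derive_on_pair; auto.
Qed.

End antiderivative.

(** * Local existence of solutions *)

Section picard.
Context {R : realType}.

Definition lipschitz_ball (V W : normedModType R) (X : V -> W) x r L :=
  forall y z, `|y - x| <= r -> `|z - x| <= r -> `|X y - X z| <= L * `|y - z|.

Lemma cvg_half_power (c : R) : (fun n => c / 2 ^+ n) @ \oo --> (0 : R).
Proof.
rewrite -(mulr0 c); apply: cvgM; first exact: cvg_cst.
under eq_fun do rewrite -exprVn.
by apply: cvg_expr; rewrite gtr0_norm ?invf_lt1 ?invr_gt0 ?ltr1n.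
Qed.

Lemma le_half_power (a b c : R) : (forall n, a <= b + c / 2 ^+ n) -> a <= b.
Proof.
move=> abc; apply: (@cvgr_to_ge _ _ eventually_filter _ (fun n => b + c / 2 ^+ n)).
  rewrite -[X in _ --> X]addr0; apply: cvgD; first exact: cvg_cst.
  exact: cvg_half_power.
exact: nearW.
Qed.

(** The form of completeness that Picard iteration uses. It passes to products
    coordinate by coordinate, which carries it from [Theta] to the phase space
    [Theta * Theta]. *)
Definition geometrically_complete (E : normedModType R) :=
  forall (x : nat -> E) (c : R),
  (forall n k, `|x (n + k)%N - x n| <= c / 2 ^+ n) ->
  exists l, forall n, `|l - x n| <= c / 2 ^+ n.

Lemma geometrically_complete_complete (E : completeNormedModType R) :
  geometrically_complete E.
Proof.
move=> x c xc; have cvgx : cvg (x @ \oo).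
  apply/cauchy_cvgP/cauchy_ballP => e e0.
  have e20 : 0 < e / 2 by rewrite divr_gt0.
  have [N _ NP] := (cvgr0Pnorm_lt _).1 (cvg_half_power c) _ e20.
  have xN n : (N <= n)%N -> `|x n - x N| < e / 2.
    move=> Nn; rewrite -(subnKC Nn) (le_lt_trans (xc _ _))//.
    by rewrite (le_lt_trans (ler_norm _))// NP/=.
  exists ([set x n | n in [set n | (N <= n)%N]], [set x n | n in [set n | (N <= n)%N]]).
    by split; exists N => // n Nn; exists n.
  move=> [_ _] /= [[m Nm <-] [n Nn <-]]; rewrite -ball_normE /=.
  rewrite (le_lt_trans (ler_distD (x N) _ _))// (splitr e) ltrD ?xN//.
  by rewrite distrC xN.
exists (lim (x @ \oo)) => n.
apply: (@cvgr_to_le _ _ eventually_filter _ (fun m => `|x m - x n|)).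
  by apply: cvg_norm; apply: cvgB; [exact: cvgx|exact: cvg_cst].
by exists n => // m /= nm; rewrite -(subnKC nm).
Qed.

Lemma norm_pair_le (V W : normedModType R) (p : V * W) (r : R) :
  (`|p| <= r) = (`|p.1| <= r) && (`|p.2| <= r).
Proof. by rewrite prod_normE ge_max. Qed.

Lemma norm_fst_le (V W : normedModType R) (p : V * W) : `|p.1| <= `|p|.
Proof. by have := lexx `|p|; rewrite {1}norm_pair_le => /andP[]. Qed.

Lemma norm_snd_le (V W : normedModType R) (p : V * W) : `|p.2| <= `|p|.
Proof. by have := lexx `|p|; rewrite {1}norm_pair_le => /andP[]. Qed.

Lemma geometrically_complete_pair (V W : normedModType R) :
  geometrically_complete V -> geometrically_complete W ->
  geometrically_complete (V * W)%type.
Proof.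
move=> hV hW x c xc.
have [l1 l1P] : exists l, forall n, `|l - (x n).1| <= c / 2 ^+ n.
  by apply: hV => n k; apply: le_trans (xc n k); exact: (norm_fst_le (_ - _)).
have [l2 l2P] : exists l, forall n, `|l - (x n).2| <= c / 2 ^+ n.
  by apply: hW => n k; apply: le_trans (xc n k); exact: (norm_snd_le (_ - _)).
by exists (l1, l2) => n; rewrite norm_pair_le l1P l2P.
Qed.

Lemma lipschitz_continuous (E : normedModType R) (f : R -> E) (k : R) :
  (forall s t, `|f s - f t| <= k * `|s - t|) -> continuous f.
Proof.
move=> fk t; apply/cvgrPdist_le => e e0; near=> s.
rewrite (le_trans (fk _ _))// (le_trans (ler_wpM2r (normr_ge0 _) (ler_norm k)))//.
have k0 : 0 < `|k| + 1 by rewrite ltr_wpDl.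
apply: (@le_trans _ _ ((`|k| + 1) * `|t - s|)); first by rewrite ler_wpM2r// lerDl.
rewrite -ler_pdivlMl//; near: s; apply: cvgr_dist_le; first exact: cvg_id.
by rewrite mulr_gt0// invr_gt0.
Unshelve. all: by end_near. Qed.

Lemma antiderivative_lipschitz (E : normedModType R) (c C : R -> E) (D : R) :
  (forall t, `|t| < 1 -> is_derive_on setT C t (c t)) ->
  (forall t, `|c t| <= D) ->
  forall a b, `|a| < 1 -> `|b| < 1 -> `|C b - C a| <= D * `|b - a|.
Proof.
move=> dC cD a b; wlog ab : a b / a <= b => [ge|].
  have [/ge//|/ltW ba a1 b1] := leP a b.
  by rewrite distrC (distrC (C b)); exact: ge.
rewrite !ltr_norml (ger0_norm (_ : 0 <= b - a)) ?subr_ge0// => /andP[a1 _] /andP[_ b1].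
apply: mean_value_ineq => // t /andP[ta tb].
apply/is_derive_onP => e e0.
have /is_derive_onP/(_ e e0) : is_derive_on setT C t (c t).
  by apply: dC; rewrite ltr_norml; apply/andP; split; lra.
by apply: filterS => s /(_ Logic.I).
Qed.

(** The retraction of the line onto [[-d, d]]. Precomposing with it makes every
    Picard iterate a globally defined curve that stays in the ball where the
    field is controlled. *)
Definition clamp (d t : R) := Num.max (- d) (Num.min d t).

Lemma norm_clamp d t : 0 <= d -> `|clamp d t| <= d.
Proof.
by move=> d0; rewrite /clamp ler_norml le_max lexx ge_max ge_min lexx/=; lra.
Qed.

Lemma clamp_id d t : `|t| <= d -> clamp d t = t.
Proof.
by rewrite ler_norml => /andP[dt td]; rewrite /clamp min_r// max_r.
Qed.

Lemma clamp_lipschitz d s t : 0 <= d -> `|clamp d s - clamp d t| <= `|s - t|.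
Proof.
move=> d0; have [s1 s2] : s - t <= `|s - t| /\ t - s <= `|s - t|.
  by split; [exact: ler_norm|rewrite distrC ler_norm].
rewrite /clamp /Num.max /Num.min ler_norml; have [ds|sd] := ltP d s;
  have [dt|td] := ltP d t; do ?case: ltP => ?; apply/andP; split; lra.
Qed.

Section iteration.
Variables (E : normedModType R) (X : E -> E) (x0 : E) (r L : R).
Hypotheses (hC : geometrically_complete E) (r0 : 0 < r) (L0 : 0 < L).
Hypothesis XL : lipschitz_ball X x0 r L.

(* [K] bounds the field on the ball. The three bounds on [d] keep the curves in
   the window of the antiderivatives, keep them in the ball, and make the
   Picard map a contraction. *)
Let K := `|X x0| + L * r.
Let d := Num.min (2^-1) (Num.min (r / K) ((2 * L)^-1)).

Let admissible (u : R -> E) := (forall t, `|u t - x0| <= r) /\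
  forall s t, `|u s - u t| <= K * `|s - t|.

Let K0 : 0 < K.
Proof. by rewrite ltr_wpDl// mulr_gt0. Qed.

Let d0 : 0 < d.
Proof. by rewrite !lt_min !invr_gt0 divr_gt0 ?mulr_gt0//= ltr0n. Qed.

Let d_lt1 : d < 1.
Proof.
by rewrite (@le_lt_trans _ _ 2^-1)// ?ge_min ?lexx// invf_lt1// ltr1n.
Qed.

Let Kd : K * d <= r.
Proof.
rewrite mulrC -ler_pdivlMr// /d; by rewrite !ge_min lexx/= orbT.
Qed.

Let Ld D : 0 <= D -> L * D * d <= D / 2.
Proof.
move=> D0; have : d <= (2 * L)^-1 by rewrite !ge_min lexx !orbT.
rewrite -[X in _ <= X]mul1r ler_pdivlMr ?mulr_gt0// => dL.
by have := ler_wpM2l D0 dL; lra.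
Qed.

Let clamp1 t : `|clamp d t| < 1.
Proof. by rewrite (le_lt_trans (norm_clamp _ (ltW d0))). Qed.

Let normX y : `|y - x0| <= r -> `|X y| <= K.
Proof.
move=> yr; rewrite -(subrK (X x0) (X y)) (le_trans (ler_normD _ _))// addrC lerD//.
have x0r : `|x0 - x0| <= r by rewrite subrr normr0 ltW.
by rewrite (le_trans (XL yr x0r))// ler_wpM2l// ltW.
Qed.

Lemma continuous_field u : admissible u -> continuous (X \o u).
Proof.
move=> [ur uK]; apply: (@lipschitz_continuous _ _ (L * K)) => s t /=.
by rewrite (le_trans (XL _ _))// -mulrA ler_wpM2l// ltW.
Qed.

(** The Picard map [S] preserves the [K]-Lipschitz curves with values in the
    ball and halves uniform distances, because [d <= (2 L)^-1]. Its iterates from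
    the constant curve therefore converge geometrically to a fixed point. *)
Lemma picard_of_antiderivative (prim : (R -> E) -> R -> E) :
  (forall u, admissible u -> prim u 0 = 0) ->
  (forall u, admissible u -> forall t, `|t| < 1 -> is_derive_on setT (prim u) t (X (u t))) ->
  exists2 d, 0 < d & exists2 u : R -> E, u 0 = x0 &
    forall t, `|t| < d -> is_derive_on setT u t (X (u t)).
Proof.
move=> prim0 primD; pose S (u : R -> E) t := x0 + prim u (clamp d t).
have primK u s t : admissible u -> `|s| < 1 -> `|t| < 1 ->
    `|prim u s - prim u t| <= K * `|s - t|.
  move=> uA s1 t1.
  apply: (antiderivative_lipschitz (primD _ uA)) => // z.
  by apply: normX; apply: uA.1.
have norm01 : `|0 : R| < 1 by rewrite normr0.
have SA u : admissible u -> admissible (S u).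
  move=> uA; split => [t|s t]; rewrite /S.
    rewrite addrC addKr -[prim u _]subr0 -(prim0 u uA) (le_trans (primK _ _ _ uA _ _))//.
    by rewrite subr0 (le_trans _ Kd)// ler_wpM2l ?(ltW K0)// norm_clamp// ltW.
  rewrite opprD addrACA subrr add0r.
  rewrite (le_trans (primK _ _ _ uA _ _))// ler_wpM2l ?(ltW K0)//.
  by rewrite clamp_lipschitz// ltW.
have S_contract u w D : admissible u -> admissible w ->
    (forall t, `|u t - w t| <= D) -> forall t, `|S u t - S w t| <= D / 2.
  move=> uA wA uw t; have D0 : 0 <= D by apply: le_trans (uw 0).
  have dP z : `|z| < 1 -> is_derive_on setT (fun z => prim u z - prim w z) z
      (X (u z) - X (w z)).
    by move=> z1; apply: is_derive_onB; [exact: primD|exact: primD].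
  have XD z : `|X (u z) - X (w z)| <= L * D.
    by rewrite (le_trans (XL (uA.1 z) (wA.1 z)))// ler_wpM2l// ltW.
  have := antiderivative_lipschitz dP XD norm01 (clamp1 t).
  rewrite !prim0// !subr0 /S opprD addrACA subrr add0r => /le_trans; apply.
  rewrite (le_trans _ (Ld D0))// ler_wpM2l ?mulr_ge0 ?(ltW L0)//.
  by rewrite norm_clamp// ltW.
pose U n := iter n S (cst x0).
have U0A : admissible (cst x0).
  by split=> [t|s t]; rewrite /cst subrr normr0 ?mulr_ge0//; exact: ltW.
have UA n : admissible (U n) by elim: n => [|n IH]//=; exact: SA.
have UC t n k : `|U (n + k)%N t - U n t| <= r / 2 ^+ n.
  elim: n t => [|n IH] t; first by rewrite expr0 divr1; apply: (UA _).1.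
  rewrite addSn /U !iterS exprSr invfM mulrA.
  by apply: (S_contract) => //; [exact: UA|exact: UA].
have /choice[u uU] t : exists l, forall n, `|l - U n t| <= r / 2 ^+ n.
  by apply: hC => n k; exact: UC.
have uA : admissible u.
  split=> [t|s t].
    apply: (@le_half_power _ _ r) => n.
    by rewrite (le_trans (ler_distD (U n t) _ _))// addrC lerD//; exact: (UA n).1.
  apply: (@le_half_power _ _ (r + r)) => n.
  rewrite (le_trans (ler_distD (U n t) _ _))// [(r + r) / _]mulrDl addrA lerD//; last first.
    by rewrite distrC.
  rewrite (le_trans (ler_distD (U n s) _ _))// addrC lerD//.
  exact: (UA n).2.
have uS t : u t = S u t.
  apply/eqP; rewrite -subr_eq0 -normr_le0; apply: (@le_half_power _ _ r) => n.
  rewrite add0r (le_trans (ler_distD (U n.+1 t) _ _))//.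
  rewrite (splitr (r / _)) lerD//.
    by rewrite (le_trans (uU t n.+1))// exprSr invfM mulrA.
  by apply: (S_contract (U n) u) => // s; rewrite distrC.
exists d => //; exists u.
  by rewrite uS /S clamp_id ?normr0 ?ltW// prim0// addr0.
move=> t td; apply/is_derive_onP => e e0.
have /is_derive_onP/(_ e e0) := primD u uA t (lt_trans td d_lt1).
have : \forall s \near t, `|t - s| < d - `|t|.
  apply/nbhs_ballP; exists (d - `|t|); first by rewrite /= subr_gt0.
  by move=> s; rewrite -ball_normE.
apply: filterS2 => s ts /(_ Logic.I) + _.
have sd : `|s| < d.
  have := ler_normD (s - t) t; rewrite subrK => /le_lt_trans; apply.
  by rewrite distrC; lra.
have -> : u s - u t = prim u s - prim u t; last by [].
rewrite (uS s) (uS t) /S !clamp_id ?(ltW sd) ?(ltW td)//.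
by rewrite opprD addrACA subrr add0r.
Qed.

End iteration.

Lemma picard (E : normedModType R) (X : E -> E) x0 (r L : R) :
  geometrically_complete E -> has_antiderivatives E ->
  0 < r -> lipschitz_ball X x0 r L ->
  exists2 d, 0 < d & exists2 u : R -> E, u 0 = x0 &
    forall t, `|t| < d -> is_derive_on setT u t (X (u t)).
Proof.
move=> hC hE r0; wlog L0 : L / 0 < L => [wl XL|XL].
  apply: (wl (`|L| + 1)) => [|y z yr zr]; first by rewrite ltr_wpDl.
  rewrite (le_trans (XL y z yr zr))// ler_wpM2r//.
  by rewrite (le_trans (ler_norm _))// lerDl.
have /choice[prim primP] (u : R -> E) : exists C : R -> E,
    continuous (X \o u) -> C 0 = 0 /\
    forall t, `|t| < 1 -> is_derive_on setT C t (X (u t)).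
  have [cu|] := pselect (continuous (X \o u)); last by exists 0.
  by have [C C0 CD] := hE _ cu; exists C.
apply: (@picard_of_antiderivative E X x0 r L hC r0 L0 XL prim).
- move=> u uA; exact: (primP u (continuous_field L0 XL uA)).1.
- move=> u uA; exact: (primP u (continuous_field L0 XL uA)).2.
Qed.

End picard.

(** * Local Lipschitz bounds *)

Section lipschitz.
Context {R : realType}.

Lemma nbhs_norm_le (V : normedModType R) (x : V) (P : set V) :
  nbhs x P -> exists2 r, 0 < r & forall y, `|y - x| <= r -> P y.
Proof.
move=> /nbhs_ballP[e /= e0 xP]; exists (e / 2); first by rewrite divr_gt0.
move=> y yx; apply: xP; rewrite -ball_normE /= distrC (le_lt_trans yx)//.
by rewrite ltr_pdivrMr// mulr_natr mulr2n ltrDl.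
Qed.

Lemma locally_lipschitz_ball (V W : normedModType R) (F : V -> W) :
  locally_lipschitz F -> forall x,
  exists2 r, 0 < r & exists2 K, 0 <= K & lipschitz_ball F x r K.
Proof.
move=> FL x; have [U /nbhs_norm_le[r r0 rU] [K [_ KF]]] := FL x.
exists r => //; exists (Num.max (K + 1) 0); first by rewrite le_max lexx orbT.
move=> y z yr zr; apply: (KF _ _ (y, z)); last by split; exact: rU.
by rewrite lt_max ltrDl ltr01.
Qed.

Lemma lipschitz_ballW (V W : normedModType R) (F : V -> W) x r r' K K' :
  r' <= r -> K <= K' -> lipschitz_ball F x r K -> lipschitz_ball F x r' K'.
Proof.
move=> rr KK FK y z yr zr; rewrite (le_trans (FK y z _ _)) ?(le_trans _ rr)//.
by rewrite ler_wpM2r.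
Qed.

(** Balls are convex, so the one-variable statement applies along the segment
    from [z] to [y]. *)
Lemma lipschitz_ball_local (V W : normedModType R) (f : V -> W) x r K :
  (forall y e, `|y - x| <= r -> 0 < e ->
    \forall z \near y, `|f z - f y| <= (K + e) * `|z - y|) ->
  lipschitz_ball f x r K.
Proof.
move=> fK y z yr zr; pose g (s : R) := z + s *: (y - z).
have gD s t : g s - g t = (s - t) *: (y - z).
  by rewrite /g opprD addrACA subrr add0r -scalerBl.
have gx s : 0 <= s <= 1 -> `|g s - x| <= r.
  move=> /andP[s0 s1].
  have -> : g s - x = s *: (y - x) + (1 - s) *: (z - x).
    rewrite /g scalerBl scale1r addrCA -scalerBr opprB addrA subrK.
    by rewrite addrAC.
  rewrite (le_trans (ler_normD _ _))// !normrZ !ger0_norm ?subr_ge0//.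
  have := ler_wpM2l s0 yr; have s1' : 0 <= 1 - s by rewrite subr_ge0.
  by have := ler_wpM2l s1' zr; lra.
have gc : continuous g.
  apply: (@lipschitz_continuous _ _ _ `|y - z|) => s t.
  by rewrite gD normrZ mulrC.
have := @local_to_global_lipschitz _ _ (f \o g) 0 1 (K * `|y - z|) ler01.
rewrite subr0 mulr1 /= /g scale1r scale0r addr0 (addrC z) subrK; apply.
move=> t e t01 e0; have k0 : 0 < `|y - z| + 1 by rewrite ltr_wpDl.
have : \forall s \near t, `|f (g s) - f (g t)| <=
    (K + e / (`|y - z| + 1)) * `|g s - g t|.
  exact: gc t _ (fK _ _ (gx t t01) (divr_gt0 e0 k0)).
apply: filterS => s /= + _; rewrite -/(g s) -/(g t) gD normrZ => /le_trans; apply.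
rewrite mulrCA mulrC ler_wpM2r// mulrDl lerD2l mulrAC ler_pdivrMr//.
by rewrite ler_wpM2l ?(ltW e0)// lerDl.
Qed.

(** The second derivative is continuous, hence bounded by some [M1] on a small
    ball. Integrating along segments, the first derivative is [M1]-Lipschitz and
    so bounded there, and then [f] itself is Lipschitz. One constant [M] serves
    for all three bounds. *)
Lemma C2_lipschitz_ball (V W : normedModType R) (f : V -> W) (x : V) : C2 f ->
  exists2 r, 0 < r & exists2 M, 0 <= M &
  [/\ lipschitz_ball f x r M,
      forall y, `|y - x| <= r -> forall w, `|'d f y w| <= M * `|w|
    & forall w, lipschitz_ball (fun y => 'd f y w) x r (M * `|w|)].
Proof.
move=> [df [D2 [D2b D2d D2c]]]; have [M0 D2x] := D2b x.
have [r r0 D2r] := nbhs_norm_le (D2c x 1 ltr01).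
have [k k0 dfx] := linear_lipschitz (diff_continuous (df x)).
(* [M0] bounds the second derivative at [x], and [1] is how far it may move *)
pose M1 := `|M0| + 1.
have D2M y : `|y - x| <= r -> forall h w, `|D2 y h w| <= M1 * `|h| * `|w|.
  move=> yr h w; rewrite -(subrK (D2 x h w) (D2 y h w)) (le_trans (ler_normD _ _))//.
  rewrite /M1 !mulrDl addrC lerD ?D2r// (le_trans (D2x h w))//.
  by rewrite !ler_wpM2r// ler_norm.
have dL w : lipschitz_ball (fun y => 'd f y w) x r (M1 * `|w|).
  apply: lipschitz_ball_local => y e yr e0.
  have w0 : 0 < `|w| + 1 by rewrite ltr_wpDl.
  have := D2d y _ (divr_gt0 e0 w0); rewrite (near_shift y 0).
  apply: filterS => z /= /(_ w); rewrite sub0r addrCA subrr addr0 => dz.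
  rewrite -(subrK (D2 y (z - y) w) (_ - _)) (le_trans (ler_normD _ _))//.
  rewrite addrC mulrDl lerD//; first by rewrite mulrAC D2M.
  rewrite (le_trans dz)// mulrAC ler_wpM2r// mulrAC ler_pdivrMr//.
  by rewrite ler_wpM2l ?(ltW e0)// lerDl.
have M10 : 0 <= M1 by rewrite addr_ge0.
pose M := k + M1 * r + M1.
have kM : k + M1 * r <= M by rewrite lerDl.
have M1M : M1 <= M by rewrite lerDr addr_ge0 ?mulr_ge0// ltW.
have dM y : `|y - x| <= r -> forall w, `|'d f y w| <= M * `|w|.
  move=> yr w; rewrite -(subrK ('d f x w) ('d f y w)) (le_trans (ler_normD _ _))//.
  apply: le_trans (ler_wpM2r (normr_ge0 w) kM); rewrite addrC mulrDl lerD//.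
  rewrite (le_trans (dL w _ _ yr _)) ?subrr ?normr0 ?(ltW r0)//.
  by rewrite mulrAC ler_wpM2r// ler_wpM2l.
exists r => //; exists M; first by rewrite (le_trans M10).
split => //; last by move=> w; apply: lipschitz_ballW (dL w); rewrite // ler_wpM2r.
apply: lipschitz_ball_local => y e yr e0.
have [_ /eqaddoP fy] := (diff_locallyP _ _).1 (df y).
have : \forall h \near (0 : V), `|f (h + y) - (f y + 'd f y h)| <= e * `|h|.
  exact: fy _ e0.
rewrite (near_shift y 0); apply: filterS => z /=; rewrite sub0r subrK => fz.
rewrite -(subrK ('d f y (z - y)) (_ - _)) (le_trans (ler_normD _ _))//.
rewrite addrC mulrDl lerD ?dM//; apply: le_trans fz.
by rewrite opprD addrA.
Qed.

End lipschitz.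

Section field.
Context {R : realType} {Theta : finHilbertType R} {H : hilbertType R}.
Variables (Phi : Theta -> H) (F : H -> H) (tau eps : R).

Definition acceleration (theta v : Theta) : Theta :=
  tau ^- 2 *: (grad Phi F theta - Meps Phi eps theta v).

Definition vector_field (p : Theta * Theta) : Theta * Theta :=
  (p.2, acceleration p.1 p.2).

Lemma inner_Jac_adj theta y w :
  inner (Jac_adj Phi theta y) w = inner y ('d Phi theta w).
Proof. exact: adjointP. Qed.

Lemma norm_Jac_adj_le theta (M : R) y : 0 <= M ->
  (forall w, `|'d Phi theta w| <= M * `|w|) -> `|Jac_adj Phi theta y| <= M * `|y|.
Proof.
move=> M0 JM; apply: norm_le_inner => [|w]; first by rewrite mulr_ge0.
have -> := inner_Jac_adj theta y w; rewrite (le_trans (cauchy_schwarz _ _))//.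
by rewrite (mulrC M) -mulrA ler_wpM2l.
Qed.

Hypotheses (hPhi : C2 Phi) (hF : locally_lipschitz F).

(** All the ingredients [residual], [Jac] and [Jac_adj] are bounded and Lipschitz
    on the ball, and the acceleration is built from them by products and sums. *)
Lemma lipschitz_vector_field p0 :
  exists2 r, 0 < r & exists L, lipschitz_ball vector_field p0 r L.
Proof.
have [r1 r10 [M M0 [PhiM JM JL]]] := C2_lipschitz_ball p0.1 hPhi.
have [r2 r20 [K K0 FK]] := locally_lipschitz_ball hF (Phi p0.1).
(* within [r] of [p0.1], the image by [Phi] stays in the ball where [F] is
   Lipschitz *)
pose r := Num.min r1 (r2 / (M + 1)).
have M10 : 0 < M + 1 by rewrite ltr_wpDl.
have r0 : 0 < r by rewrite lt_min r10 divr_gt0.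
have rr1 : r <= r1 by rewrite ge_min lexx.
have Mr : M * r <= r2.
  have : r <= r2 / (M + 1) by rewrite ge_min lexx orbT.
  by rewrite ler_pdivlMr// => h; have := ltW r0; nra.
exists r => //.
(* bounds of the residual and of the velocity on the ball *)
pose B := `|F (Phi p0.1)| + K * r2.
pose V0 := `|p0.2| + r.
have B0 : 0 <= B by rewrite addr_ge0 ?mulr_ge0// ltW.
have V00 : 0 <= V0 by rewrite addr_ge0// ltW.
pose L2 := M * (K * M) + M * B + (M * (M * V0 + M) + M * (M * V0)) + eps ^+ 2.
have L20 : 0 <= L2.
  by rewrite /L2 !addr_ge0 ?sqr_ge0// !mulr_ge0// ?addr_ge0 ?mulr_ge0.
exists (1 + tau ^- 2 * L2) => -[y v] [z w]; rewrite !norm_pair_le /=.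
move=> /andP[yr _] /andP[zr wr].
have yr1 := le_trans yr rr1; have zr1 := le_trans zr rr1.
set D := `|(y, v) - (z, w)|.
have yzD : `|y - z| <= D by exact: (norm_fst_le ((y, v) - (z, w))).
have vwD : `|v - w| <= D by exact: (norm_snd_le ((y, v) - (z, w))).
have D0 : 0 <= D by exact: normr_ge0.
have tau0 : 0 <= tau ^- 2 by rewrite invr_ge0 sqr_ge0.
have wV0 : `|w| <= V0.
  by rewrite -(subrK p0.2 w) (le_trans (ler_normD _ _))// addrC lerD2l.
apply/andP; split => /=.
  by rewrite (le_trans vwD)// mulrDl mul1r lerDl !mulr_ge0.
rewrite /acceleration -scalerBr normrZ ger0_norm// mulrDl mul1r.
apply: (@le_trans _ _ (tau ^- 2 * L2 * D)); last by rewrite lerDr.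
rewrite -mulrA ler_wpM2l//.
have Phir x : `|x - p0.1| <= r -> `|Phi x - Phi p0.1| <= r2.
  move=> xr; have p0r : `|p0.1 - p0.1| <= r1 by rewrite subrr normr0 ltW.
  rewrite (le_trans (PhiM _ _ (le_trans xr rr1) p0r))//.
  by rewrite (le_trans _ Mr)// ler_wpM2l.
have FL : `|residual Phi F y - residual Phi F z| <= K * M * D.
  rewrite (le_trans (FK _ _ (Phir y yr) (Phir z zr)))// -mulrA ler_wpM2l//.
  by rewrite (le_trans (PhiM _ _ yr1 zr1))// ler_wpM2l.
have FB : `|residual Phi F z| <= B.
  rewrite -(subrK (F (Phi p0.1)) (residual Phi F z)) (le_trans (ler_normD _ _))//.
  have Phi0 : `|Phi p0.1 - Phi p0.1| <= r2 by rewrite subrr normr0 ltW.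
  rewrite addrC lerD2l (le_trans (FK _ _ (Phir z zr) Phi0))//.
  by rewrite ler_wpM2l// Phir.
have JyzD u : `|'d Phi y u - 'd Phi z u| <= M * D * `|u|.
  by rewrite (le_trans (JL u y z yr1 zr1))// mulrAC ler_wpM2r// ler_wpM2l.
have MD0 : 0 <= M * D by rewrite mulr_ge0.
have gradL : `|grad Phi F y - grad Phi F z| <= (M * (K * M) + M * B) * D.
  rewrite (le_trans (norm_adjointB_le _ _ M0 MD0 (JM y yr1) JyzD))//.
  have := ler_wpM2l M0 FL; have := ler_wpM2l MD0 FB; lra.
have Jw : `|'d Phi z w| <= M * V0.
  by rewrite (le_trans (JM z zr1 w))// ler_wpM2l.
have JvwD : `|'d Phi y v - 'd Phi z w| <= (M * V0 + M) * D.
  have -> : 'd Phi y v - 'd Phi z w =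
      ('d Phi y w - 'd Phi z w) + 'd Phi y (v - w).
    by rewrite linearB /= [RHS]addrC addrA subrK.
  rewrite (le_trans (ler_normD _ _))// mulrDl lerD//.
    by rewrite (le_trans (JyzD w))// mulrAC ler_wpM2r// ler_wpM2l.
  by rewrite (le_trans (JM y yr1 _))// ler_wpM2l.
have JJL : `|Jac_adj Phi y (Jac Phi y v) - Jac_adj Phi z (Jac Phi z w)| <=
    (M * (M * V0 + M) + M * (M * V0)) * D.
  rewrite (le_trans (norm_adjointB_le _ _ M0 MD0 (JM y yr1) JyzD))//.
  have := ler_wpM2l M0 JvwD; have := ler_wpM2l MD0 Jw; rewrite /Jac; lra.
have epsL : `|eps ^+ 2 *: v - eps ^+ 2 *: w| <= eps ^+ 2 * D.
  by rewrite -scalerBr normrZ ger0_norm ?sqr_ge0// ler_wpM2l ?sqr_ge0.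
have -> : grad Phi F y - Meps Phi eps y v - (grad Phi F z - Meps Phi eps z w) =
    (grad Phi F y - grad Phi F z) -
    ((Jac_adj Phi y (Jac Phi y v) - Jac_adj Phi z (Jac Phi z w)) +
     (eps ^+ 2 *: v - eps ^+ 2 *: w)).
  rewrite /Meps [X in _ = _ - X]addrACA -opprD !opprB.
  by rewrite addrACA (addrC (- (_ + _))) addrACA.
rewrite (le_trans (ler_normB _ _))//.
have := ler_normD (Jac_adj Phi y (Jac Phi y v) - Jac_adj Phi z (Jac Phi z w))
  (eps ^+ 2 *: v - eps ^+ 2 *: w).
by rewrite /L2; lra.
Qed.

End field.

(** * A priori bounds and continuation *)

Section continuation.
Context {R : realType}.

(** The function [f t * exp (- K t)] has nonpositive derivative. *)
Lemma gronwall (f df : R -> R) (K T : R) :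
  (forall t, 0 <= t < T -> is_derive_on `[0, T[ f t (df t)) ->
  (forall t, 0 <= t < T -> df t <= K * f t) ->
  forall t, 0 <= t < T -> f t <= f 0 * expR (K * t).
Proof.
move=> fd dfK t /andP[t0 tT]; pose h (s : R) := expR (- K * s).
have hD s : is_derive s (1 : R) h (h s * (- K)).
  apply: (@is_derive1_comp _ expR ( *%R (- K))).
  have -> : *%R (- K) = (- K) \*: (@id R) by [].
  by apply: is_derive_eq; rewrite /GRing.scale /= mulr1.
have xT x : 0 < x < t -> 0 <= x < T.
  by move=> /andP[/ltW -> xt]; rewrite (lt_trans xt).
have [||c ct E] := @MVT_segment R (f * h)
    (fun s => f s *: (h s * - K) + h s *: df s) 0 t t0.
- move=> x; rewrite in_itv /= => x0t; apply: is_deriveM => //.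
  apply/is_derive_onT; apply: (is_derive_on_near _ _ (fd x (xT x x0t))) => //.
  have : x \in `]0, t[ by rewrite in_itv.
  move=> /near_in_itvoo; apply: filterS => s; rewrite in_itv /= => s0t _.
  by split=> //; rewrite in_itv; exact: xT.
- apply/subspace_continuousP => /= x; rewrite in_itv /= => /andP[x0 xt].
  apply: cvgM.
    have {}xT : 0 <= x < T by rewrite x0 (le_lt_trans xt).
    apply: (@is_derive_on_cvg _ _ _ _ _ (df x)).
    apply: (is_derive_on_near _ _ (fd x xT)) => //.
    apply: (@filterE _ (nbhs (x : R))) => s; rewrite /= !in_itv /= => /andP[-> st].
    by rewrite (le_lt_trans st).
  apply: (cvg_trans (cvg_app h (cvg_within _))); apply: differentiable_continuous.
  by apply/derivable1_diffP; case: (hD x).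
have c0T : 0 <= c < T.
  by move: ct; rewrite in_itv /= => /andP[-> ct]; rewrite (le_lt_trans ct).
have h0 s : 0 < h s by exact: expR_gt0.
have le0 : f t * h t <= f 0.
  have -> : f 0 = (f * h) 0 by rewrite /GRing.mul /= /h mulr0 expR0 mulr1.
  rewrite -subr_le0 -[f t * h t]/((f * h) t) E mulr_le0_ge0//; last by rewrite subr0.
  rewrite /GRing.scale /=.
  by have := ler_wpM2l (ltW (h0 c)) (dfK c c0T); lra.
by rewrite -ler_pdivrMr ?expR_gt0// -expRN -mulNr.
Qed.

(** The values of [u] at the times [T - (T - a) / 2 ^ n] converge geometrically,
    and the distance from [s] to these times, on either side, is at most [T - s]
    up to an error that vanishes as [n] grows. *)
Lemma lipschitz_left_limit (V : completeNormedModType R) (u : R -> V) (a T K : R) :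
  a < T -> (forall s t, a <= s -> s <= t -> t < T -> `|u t - u s| <= K * (t - s)) ->
  exists l, forall s, a <= s < T -> `|l - u s| <= K * (T - s).
Proof.
move=> aT uK; pose t n := T - (T - a) / 2 ^+ n.
have h0 n : 0 < (T - a) / 2 ^+ n by rewrite divr_gt0 ?subr_gt0 ?exprn_gt0.
have tT n : t n < T by rewrite /t ltrBlDr ltrDl.
have half n k : (T - a) / 2 ^+ (n + k) <= (T - a) / 2 ^+ n.
  rewrite ler_wpM2l ?subr_ge0 ?(ltW aT)// lef_pV2 ?posrE ?exprn_gt0//.
  by rewrite ler_eXn2l ?ltr1n// leq_addr.
have at_ n : a <= t n.
  by have := half 0 n; rewrite add0n expr0 divr1 /t; lra.
have tD n k : t (n + k)%N - t n <= (T - a) / 2 ^+ n.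
  by have := h0 (n + k)%N; rewrite /t; lra.
have K0 : 0 <= K.
  have m1 : a < (a + T) / 2 by lra.
  have m2 : (a + T) / 2 < T by lra.
  have := le_trans (normr_ge0 _) (uK _ _ (lexx a) (ltW m1) m2).
  by rewrite pmulr_lge0// subr_gt0.
have [l lu] : exists l, forall n, `|l - u (t n)| <= K * (T - a) / 2 ^+ n.
  apply: geometrically_complete_complete => n k; rewrite -mulrA.
  rewrite (le_trans (uK (t n) (t (n + k)%N) _ _ _))//; last by rewrite ler_wpM2l.
  by have := half n k; rewrite /t; lra.
exists l => s /andP[as_ sT].
apply: (@le_half_power _ _ _ (K * (T - a) + K * (T - a))) => n.
rewrite (le_trans (ler_distD (u (t n)) _ _))// mulrDl addrA addrC lerD//.
have [st|/ltW ts] := leP s (t n).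
  rewrite (le_trans (uK _ _ as_ st (tT n)))// -mulrA -mulrDr ler_wpM2l//.
  by have := h0 n; have := tT n; lra.
rewrite distrC (le_trans (uK _ _ (at_ n) ts sT))// -mulrA -mulrDr ler_wpM2l//.
by rewrite /t; have := sT; lra.
Qed.

(** The mean value inequality for [z |-> p z - z l'] on [[s, t]], as [t] tends to
    [T]. If [p'] tends to [l'], then [e] can be taken arbitrarily small, and [l']
    is the left derivative at [T] of the extension of [p] by its limit [l]. *)
Lemma left_derivative (E : normedModType R) (p : R -> E) (p' : R -> E)
    (T a K b : R) (l l' : E) : a < T -> a <= b < T ->
  (forall t, a <= t < T -> is_derive_on `[a, T[ p t (p' t)) ->
  (forall s, a <= s < T -> `|l - p s| <= K * (T - s)) ->
  forall e, (forall s, b <= s < T -> `|p' s - l'| <= e) ->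
  forall s, b <= s < T -> `|l - p s - (T - s) *: l'| <= e * (T - s).
Proof.
move=> aT /andP[ab bT] dp pl e pe s /andP[bs sT].
apply: (@le_half_power _ _ _ ((K + `|l'|) * (T - s))) => n.
pose h := (T - s) / 2 ^+ n; have [t tE] : exists t, t = T - h by exists (T - h).
have h0 : 0 < h by rewrite divr_gt0 ?subr_gt0 ?exprn_gt0.
have hs : h <= T - s.
  rewrite ler_pdivrMr ?exprn_gt0// ler_peMr ?subr_ge0 ?(ltW sT)//.
  by rewrite exprn_ege1// ler1n.
have st : s <= t by rewrite tE; lra.
have tT : t < T by rewrite tE; lra.
pose g z := p z - z *: l'.
have gst : `|g t - g s| <= e * (t - s).
  apply: (@mean_value_ineq _ _ _ (fun z => p' z - l')) => // z /andP[sz zt].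
    apply: is_derive_onB; last first.
      by rewrite -[X in is_derive_on _ _ _ X]scale1r; apply: is_derive_on_scale;
        exact: is_derive_on_id.
    apply: (is_derive_on_near _ _ (dp z _)) => //; last by apply/andP; split; lra.
    apply: (@filterE _ (nbhs z)) => y; rewrite /= !in_itv /= => /andP[sy yt]; split => //.
    by apply/andP; split; lra.
  by apply: pe; apply/andP; split; lra.
have -> : l - p s - (T - s) *: l' = (l - p t) + (g t - g s) - (T - t) *: l'.
  have -> : g t - g s = (p t - p s) - (t - s) *: l'.
    by rewrite /g scalerBl !opprB addrACA (addrC (- (t *: l'))) addrACA.
  rewrite !addrA subrK -[RHS]addrA -opprD -scalerDl.
  by congr (_ - _ *: _); ring.
rewrite (le_trans (ler_normB _ _))// -mulrA -/h.
have := ler_normD (l - p t) (g t - g s).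
have := pl t; rewrite tT (le_trans ab (le_trans bs st)) => /(_ isT).
rewrite normrZ gtr0_norm ?subr_gt0//.
have -> : T - t = h by rewrite tE; ring.
have e0 : 0 <= e by apply: le_trans (pe s _); rewrite ?bs.
have : e * (t - s) <= e * (T - s) by rewrite ler_wpM2l// lerD2r ltW.
lra.
Qed.

(** Before and after [T] the glued curve coincides locally with a solution. At
    [T] its right derivative is that of [w] and its left derivative is the limit
    of [X (p t)], both equal to [X l]. *)
Lemma ode_extend (E : normedModType R) (X : E -> E) (p w : R -> E) (T a K d r L : R)
    (l : E) : 0 <= a < T -> 0 < d -> 0 < r ->
  (forall t, 0 <= t < T -> is_derive_on `[0, T[ p t (X (p t))) ->
  (forall s, a <= s < T -> `|l - p s| <= K * (T - s)) ->
  lipschitz_ball X l r L -> w T = l ->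
  (forall t, `|t - T| < d -> is_derive_on setT w t (X (w t))) ->
  let q t := if t < T then p t else w t in
  forall t, 0 <= t < T + d -> is_derive_on `[0, T + d[ q t (X (q t)).
Proof.
move=> /andP[a0 aT] d0 r0 dp pl XL wT dw q t /andP[t0 tTd].
have [tT|Tt|tT] := ltgtP t T.
- have qt : q t = p t by rewrite /q tT.
  rewrite qt; apply: (is_derive_on_near _ _ (dp t _)) => //; last by rewrite t0.
  apply: filterS (lt_nbhsl tT) => s sT; rewrite /= !in_itv /= /q sT => /andP[-> _].
  by [].
- have qt : q t = w t by rewrite /q ltNge (ltW Tt).
  have tTd' : `|t - T| < d by rewrite gtr0_norm ?subr_gt0// ltrBlDl.
  rewrite qt; apply: (is_derive_on_near _ _ (dw t tTd')) => //.
  by apply: filterS (lt_nbhsr Tt) => s sT _; rewrite /q ltNge (ltW sT).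
- rewrite {}tT {t0 tTd t} /q ltxx wT.
  apply/is_derive_onP => e e0.
  have dT : `|T - T| < d by rewrite subrr normr0.
  have /is_derive_onP/(_ e e0) := dw T dT; rewrite wT.
  pose L' := `|L| * `|K| + 1.
  have L'0 : 0 < L' by rewrite ltr_wpDl// mulr_ge0.
  (* after [b], [p] is so close to [l] that [X] moves by at most [e] *)
  pose b := Num.max a (T - Num.min (r / (`|K| + 1)) (e / L')).
  have K10 : 0 < `|K| + 1 by rewrite ltr_wpDl.
  have bT : b < T by rewrite gt_max aT ltrBlDr ltrDl lt_min !divr_gt0.
  have ab : a <= b by rewrite le_max lexx.
  have near_l s : b <= s < T -> `|p s - l| <= r /\ `|X (p s) - X l| <= e.
    move=> /andP[bs sT]; have Ts : 0 < T - s by rewrite subr_gt0.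
    have : T - s <= Num.min (r / (`|K| + 1)) (e / L').
      by move: bs; rewrite ge_max => /andP[_]; rewrite lerBlDr -lerBlDl.
    rewrite le_min !ler_pdivlMr// => /andP[sr se].
    have pls : `|p s - l| <= `|K| * (T - s).
      rewrite distrC (le_trans (pl s _)) ?(le_trans ab bs) ?sT//.
      by rewrite ler_wpM2r ?ler_norm// ltW.
    have psr : `|p s - l| <= r by lra.
    have llr : `|l - l| <= r by rewrite subrr normr0 ltW.
    split=> //; rewrite (le_trans (XL _ _ psr llr))//.
    rewrite (@le_trans _ _ (`|L| * (`|K| * (T - s))))//; last first.
      by move: se; rewrite /L'; lra.
    by rewrite (le_trans (ler_wpM2r (normr_ge0 _) (ler_norm L)))// ler_wpM2l.
  have dpa t : a <= t < T -> is_derive_on `[a, T[ p t (X (p t)).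
    move=> /andP[at_ tT]; apply: (is_derive_on_near _ _ (dp t _)) => //.
      apply: (@filterE _ (nbhs t)) => s; rewrite /= !in_itv /= => /andP[as_ ->].
      by rewrite (le_trans a0).
    by rewrite (le_trans a0).
  have abT : a <= b < T by rewrite ab.
  have left := left_derivative aT abT dpa pl (fun s h => (near_l s h).2).
  apply: filterS2 (lt_nbhsr bT) => s bs /(_ Logic.I) ws _.
  rewrite ltxx; have [sT|//] := ltP s T.
  have := left s; rewrite (ltW bs) sT => /(_ isT).
  have -> : p s - l - (s - T) *: X l = - (l - p s - (T - s) *: X l).
    by rewrite -scaleNr !opprB addrC.
  have -> : `|s - T| = T - s by rewrite distrC ger0_norm// subr_ge0 ltW.
  by rewrite normrN.
Qed.

End continuation.

Section system.
Context {R : realType} {Theta : finHilbertType R} {H : hilbertType R}.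
Variables (Phi : Theta -> H) (F : H -> H) (tau eps Cg : R).
Hypothesis Cg0 : 0 <= Cg.
Hypothesis hg : forall x, `|grad Phi F x| <= Cg * (1 + `|x|).

(** The damping contributes [- tau^-2 (|J v|^2 + eps^2 |v|^2) <= 0], so only the
    gradient is left to bound. *)
Lemma inner_acceleration_le (theta v : Theta) :
  inner v (acceleration Phi F tau eps theta v) <=
  tau ^- 2 * Cg * (`|v| * (1 + `|theta|)).
Proof.
rewrite /acceleration linearZr_LR linearBr /= /GRing.scale /= -mulrA.
rewrite ler_wpM2l ?invr_ge0 ?sqr_ge0//.
have M0 : 0 <= inner v (Meps Phi eps theta v).
  rewrite /Meps linearDr linearZr_LR /= innerxx (innerC v).
  have -> := inner_Jac_adj Phi theta (Jac Phi theta v) v.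
  rewrite -[X in inner X]/(Jac Phi theta v) -[X in inner _ X]/(Jac Phi theta v) innerxx.
  by rewrite addr_ge0 ?sqr_ge0// mulr_ge0 ?sqr_ge0.
rewrite lerBlDr (le_trans (cauchy_schwarz _ _))// mulrCA.
by rewrite (le_trans (ler_wpM2l (normr_ge0 v) (hg theta)))// lerDl.
Qed.

(** Gronwall's inequality for the energy [1 + |theta|^2 + |v|^2]. *)
Lemma energy_bound (theta v : R -> Theta) (T : R) : 0 < T ->
  (forall t, 0 <= t < T -> is_derive_on `[0, T[ theta t (v t)) ->
  (forall t, 0 <= t < T ->
    is_derive_on `[0, T[ v t (acceleration Phi F tau eps (theta t) (v t))) ->
  exists B, forall t, 0 <= t < T -> `|theta t| <= B /\ `|v t| <= B.
Proof.
move=> T0 dtheta dv; pose k := tau ^- 2 * Cg; pose K := 1 + 2 * k.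
have k0 : 0 <= k by rewrite mulr_ge0// invr_ge0 sqr_ge0.
pose E t := 1 + (`|theta t| ^+ 2 + `|v t| ^+ 2).
pose dE t := 2 * inner (theta t) (v t) +
  2 * inner (v t) (acceleration Phi F tau eps (theta t) (v t)).
have dEP t : 0 <= t < T -> is_derive_on `[0, T[ E t (dE t).
  move=> tT; rewrite -[dE t]add0r.
  apply: is_derive_onD; first exact: is_derive_on_cst.
  by apply: is_derive_onD; apply: is_derive_on_normsq; auto.
have dEK t : 0 <= t < T -> dE t <= K * E t.
  move=> tT; have := inner_acceleration_le (theta t) (v t); rewrite -/k.
  have := cauchy_schwarz (theta t) (v t); rewrite /dE /K /E.
  set x := `|theta t|; set y := `|v t| => xy ka.
  have h1 : 2 * (x * y) <= x ^+ 2 + y ^+ 2.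
    by have := sqr_ge0 (x - y); lra.
  have h2 : k * (2 * (y * (1 + x))) <= k * (2 * (1 + (x ^+ 2 + y ^+ 2))).
    rewrite ler_wpM2l//; have := sqr_ge0 (y - 1); have := sqr_ge0 x; lra.
  have := sqr_ge0 x; have := sqr_ge0 y; lra.
have EC := gronwall dEP dEK.
exists (E 0 * expR (K * T)) => t tT; move: (tT) => /andP[t0 tT'].
have E1 s : 1 <= E s by rewrite /E lerDl addr_ge0 ?sqr_ge0.
have K0 : 0 <= K by rewrite addr_ge0// mulr_ge0.
have : E t <= E 0 * expR (K * T).
  rewrite (le_trans (EC t tT))// ler_wpM2l ?(le_trans ler01 (E1 0))//.
  by rewrite ler_expR ler_wpM2l// ltW.
move=> /[dup] /(le_trans (E1 t)); move: (_ * expR _) => C C1; rewrite /E.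
have := sqr_ge0 `|theta t|; have := sqr_ge0 `|v t| => v2 th2 EtC.
(* the energy is at least [1], so [C <= C ^+ 2] *)
have bd (x : R) : 0 <= x -> x ^+ 2 <= C -> x <= C.
  move=> x0 xC; rewrite leNgt; apply/negP => Cx; nra.
by split; apply: bd => //; lra.
Qed.

Hypotheses (hPhi : C2 Phi) (hF : locally_lipschitz F) (tau0 : 0 < tau).

(** [theta] converges first, because [v] is bounded. Near the limit of [theta]
    the operators [J], hence the acceleration, are bounded: this is what the
    threshold [a] is for, and why [v] converges. *)
Lemma left_limit (theta v : R -> Theta) (T : R) : 0 < T ->
  (forall t, 0 <= t < T -> is_derive_on `[0, T[ theta t (v t)) ->
  (forall t, 0 <= t < T ->
    is_derive_on `[0, T[ v t (acceleration Phi F tau eps (theta t) (v t))) ->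
  exists a K (l : Theta * Theta), 0 <= a < T /\
    forall s, a <= s < T -> `|l - (theta s, v s)| <= K * (T - s).
Proof.
move=> T0 dtheta dv; have [B BP] := energy_bound T0 dtheta dv.
have T00 : 0 <= (0 : R) < T by rewrite lexx.
have B0 : 0 <= B := le_trans (normr_ge0 _) (BP 0 T00).1.
have dsub (u : R -> Theta) b a z l : 0 <= a -> b < T -> a <= z <= b ->
    is_derive_on `[0, T[ u z l -> is_derive_on `[a, b] u z l.
  move=> a0 bT zab; apply: is_derive_on_near => //.
  apply: (@filterE _ (nbhs z)) => y; rewrite /= !in_itv /= => /andP[ay yb].
  by rewrite (le_trans a0 ay) (le_lt_trans yb bT).
have lip (u u' : R -> Theta) a A : 0 <= a ->
    (forall t, 0 <= t < T -> is_derive_on `[0, T[ u t (u' t)) ->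
    (forall t, a <= t < T -> `|u' t| <= A) ->
    forall s t, a <= s -> s <= t -> t < T -> `|u t - u s| <= A * (t - s).
  move=> a0 du u'A s t as_ st tT; apply: mean_value_ineq => // z /andP[sz zt].
    apply: dsub; rewrite ?(le_trans a0 as_) ?sz//.
    by apply: du; rewrite (le_trans a0 (le_trans as_ sz)) (le_lt_trans zt).
  by apply: u'A; rewrite (le_trans as_ sz) (le_lt_trans zt).
have [l1 l1P] : exists l, forall s, 0 <= s < T -> `|l - theta s| <= B * (T - s).
  apply: lipschitz_left_limit => //; apply: (lip theta v) => // t tT.
  exact: (BP t tT).2.
have [r r0 [M M0 [_ JM _]]] := C2_lipschitz_ball l1 hPhi.
have B1 : 0 < B + 1 by rewrite ltr_wpDl.
(* from [a] on, [theta] is in the ball where [M] bounds the operators [J] *)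
pose a := Num.max 0 (T - r / (B + 1)).
have a0 : 0 <= a by rewrite le_max lexx.
have aT : a < T by rewrite gt_max T0 ltrBlDr ltrDl divr_gt0.
have ball s : a <= s < T -> `|theta s - l1| <= r.
  move=> /andP[]; rewrite ge_max => /andP[s0]; rewrite lerBlDr -lerBlDl => sr sT.
  rewrite distrC (le_trans (l1P s _)) ?s0//.
  by move: sr; rewrite ler_pdivlMr//; lra.
pose A := tau ^- 2 * (Cg * (1 + B) + (M * (M * B) + eps ^+ 2 * B)).
have vA s : a <= s < T -> `|acceleration Phi F tau eps (theta s) (v s)| <= A.
  move=> /[dup] /ball sr /andP[as_ sT].
  have [thB vB] := BP s (introT andP (conj (le_trans a0 as_) sT)).
  rewrite /acceleration normrZ ger0_norm ?invr_ge0 ?sqr_ge0//.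
  rewrite ler_wpM2l ?invr_ge0 ?sqr_ge0// (le_trans (ler_normB _ _))// lerD//.
    by rewrite (le_trans (hg _))// ler_wpM2l// lerD2l.
  rewrite /Meps (le_trans (ler_normD _ _))// lerD//.
    rewrite (le_trans (norm_Jac_adj_le _ M0 (JM _ sr)))// ler_wpM2l//.
    by rewrite (le_trans (JM _ sr _))// ler_wpM2l.
  by rewrite normrZ ger0_norm ?sqr_ge0// ler_wpM2l ?sqr_ge0.
have [l2 l2P] := lipschitz_left_limit aT (lip v _ a A a0 dv vA).
exists a, (Num.max B A), (l1, l2); split; first by rewrite a0.
move=> s /[dup] asT /andP[as_ sT]; have Ts : 0 <= T - s by rewrite subr_ge0 ltW.
rewrite norm_pair_le /=; apply/andP; split.
  rewrite (le_trans (l1P s _)) ?(le_trans a0 as_)// ler_wpM2r//.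
  by rewrite le_max lexx.
by rewrite (le_trans (l2P s asT))// ler_wpM2r// le_max lexx orbT.
Qed.

Lemma extend_solution (theta v : R -> Theta) (T : R) : 0 < T ->
  (forall t, 0 <= t < T -> is_derive_on `[0, T[ theta t (v t)) ->
  (forall t, 0 <= t < T ->
    is_derive_on `[0, T[ v t (acceleration Phi F tau eps (theta t) (v t))) ->
  exists2 d, 0 < d & exists theta' v' : R -> Theta,
  [/\ forall t, t < T -> theta' t = theta t /\ v' t = v t,
      forall t, 0 <= t < T + d -> is_derive_on `[0, T + d[ theta' t (v' t)
    & forall t, 0 <= t < T + d -> is_derive_on `[0, T + d[ v' t
        (acceleration Phi F tau eps (theta' t) (v' t))].
Proof.
move=> T0 dtheta dv; have [a [K [l [a0T lP]]]] := left_limit T0 dtheta dv.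
have [r r0 [L XL]] := lipschitz_vector_field tau eps hPhi hF l.
have hC := @geometrically_complete_complete R Theta.
have hA := @has_antiderivatives_fin R Theta.
have [d d0 [u u0 du]] := picard (geometrically_complete_pair hC hC)
  (has_antiderivatives_pair hA hA) r0 XL.
pose w t := u (t - T).
have wT : w T = l by rewrite /w subrr.
have dw t : `|t - T| < d -> is_derive_on setT w t (vector_field Phi F tau eps (w t)).
  move=> /du /is_derive_onP ud; apply/is_derive_onP => e e0.
  have := ud e e0; rewrite (near_shift t (t - T)); apply: filterS => s /=.
  rewrite (_ : s + (t - T - t) = s - T); last by ring.
  by rewrite (_ : s - T - (t - T) = s - t)//; ring.
pose p t := (theta t, v t).
have dp t : 0 <= t < T -> is_derive_on `[0, T[ p t (vector_field Phi F tau eps (p t)).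
  by move=> tT; apply: is_derive_on_pair; auto.
have := ode_extend a0T d0 r0 dp lP XL wT dw.
set q := fun t => _; rewrite /= => dq.
exists d => //; exists (fun t => (q t).1), (fun t => (q t).2); split=> t tT.
- by rewrite /q tT.
- apply/is_derive_onP => e e0; have /is_derive_onP/(_ e e0) := dq t tT.
  apply: filterS => s /[apply]; apply: le_trans.
  exact: (norm_fst_le (q s - q t - (s - t) *: vector_field Phi F tau eps (q t))).
- apply/is_derive_onP => e e0; have /is_derive_onP/(_ e e0) := dq t tT.
  apply: filterS => s /[apply]; apply: le_trans.
  exact: (norm_snd_le (q s - q t - (s - t) *: vector_field Phi F tau eps (q t))).
Qed.

Lemma second_order_eqE (theta v a : Theta) :
  tau ^+ 2 *: a + Meps Phi eps theta v = grad Phi F theta <->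
  a = acceleration Phi F tau eps theta v.
Proof.
have t20 : tau ^+ 2 != 0 by rewrite sqrf_eq0 gt_eqF.
rewrite /acceleration; split => [<-|->].
  by rewrite addrK scalerA mulVf// scale1r.
by rewrite scalerA divff// scale1r subrK.
Qed.

Lemma time_intervalE (T : R) : time_interval T%:E = `[0, T[%classic.
Proof.
apply/seteqP; split=> t; rewrite /time_interval /= in_itv /= lte_fin.
  by move=> [-> ->].
by move=> /andP[].
Qed.

End system.

Unset Implicit Arguments.

Theorem proposition2 (R : realType) (H : hilbertType R)
    (Theta : finHilbertType R) (Phi : Theta -> H) (F : H -> H)
    (tau eps Cg : R) (hPhi : C2 Phi) (hF : locally_lipschitz F)
    (htau : 0 < tau) (heps : 0 <= eps) (hCg : 0 < Cg)
    (hg : forall theta : Theta, `|grad Phi F theta| <= Cg * (1 + `|theta|))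
    (theta0 v0 : Theta) (Tmax : \bar R) (hT : (0 < Tmax)%E)
    (theta v : R -> Theta)
    (hmax : is_maximal_solution Phi F tau eps theta0 v0 Tmax theta v) :
  Tmax = +oo%E.
Proof.
case: hmax => [[th0 vv0 sol] nomax]; move: Tmax hT sol nomax.
move=> [T||]//; rewrite lte_fin => T0 sol; case.
have tE t : time_interval T%:E t <-> 0 <= t < T.
  by rewrite time_intervalE /= in_itv.
have dtheta t : 0 <= t < T -> is_derive_on `[0, T[ theta t (v t).
  by move=> /tE /sol[]; rewrite time_intervalE.
have dv t : 0 <= t < T ->
    is_derive_on `[0, T[ v t (acceleration Phi F tau eps (theta t) (v t)).
  move=> /tE /sol[_ [a dva]]; rewrite time_intervalE in dva.
  by move=> /(second_order_eqE Phi F eps htau) <-.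
have [d d0 [theta' [v' [old dtheta' dv']]]] :=
  extend_solution (ltW hCg) hg hPhi hF T0 dtheta dv.
exists (T + d)%:E, theta', v'; split.
- by rewrite lte_fin ltrDl.
- split.
  + by rewrite (old 0 T0).1.
  + by rewrite (old 0 T0).2.
  + rewrite time_intervalE => t; rewrite /= in_itv => tTd; split; first exact: dtheta'.
    exists (acceleration Phi F tau eps (theta' t) (v' t)); first exact: dv'.
    exact/(second_order_eqE Phi F eps htau).
- by move=> t /tE /andP[_ tT]; exact: old.
Qed.
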